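(* Let $P$ be a (finite) ranked poset, let $\widehat P$ be $P$ with a new minimum $\hat 0$ and a new maximum $\hat 1$ adjoined, and let $\mathcal{G}(\widehat P)$ be the Hasse diagram of $\widehat P$ viewed as a graph. Then, for the vertices $\hat0,\hat1\in V(\mathcal{G}(\widehat P))$, $$MH_{\ast+2,\mathrm{rk}(\widehat P)}(\hat 0,\hat 1)\;\cong\;H_\ast(\Delta(P))\;\cong\;EMH_{\ast+2,\mathrm{rk}(\widehat P)}(\hat 0,\hat 1),$$ where the magnitude and Eulerian magnitude homology groups are those of the graph $\mathcal{G}(\widehat P)$ and $H_\ast$ is homology with integer coefficients.
   Context: A poset is ranked of rank $n$ if all its maximal chains $a_0<a_1<\cdots<a_n$ have the same length $n$; $\mathrm{rk}$ denotes the rank. $\mathcal{G}(Q)$ for a finite poset $Q$ is the undirected graph with vertex set $Q$ and an edge $\{a,b\}$ whenever $b$ covers $a$. $\Delta(P)$ is the order complex of $P$: its $n$-th chain group is the free abelian group on the chains $a_0<\cdots<a_n$ in $P$, i.e. it is the simplicial complex whose $n$-simplices are these chains. For a finite graph $G$, $d(a,b)$ is the least number of edges in a walk from $a$ to $b$ ($\infty$ if none). A $k$-path is a tuple $(v_0,\dots,v_k)\in V(G)^{k+1}$ with $v_i\ne v_{i+1}$ and $d(v_i,v_{i+1})<\infty$ for $0\le i\le k-1$; its length is $\sum_{i=0}^{k-1}d(v_i,v_{i+1})$. It is Eulerian if its entries are pairwise distinct. For vertices $a,b$, $MC_{k,\ell}(a,b)$ is the free abelian group on $k$-paths of length $\ell$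 with $v_0=a$, $v_k=b$; for $a\neq b$, $EMC_{k,\ell}(a,b)\subseteq MC_{k,\ell}(a,b)$ is generated by the Eulerian ones. The differential (lowering $k$ by one and preserving $\ell$) is $\partial=\sum_{i=1}^{k-1}(-1)^i\partial^i$, where $\partial^i(v_0,\dots,v_k)$ is the tuple with $v_i$ deleted if that tuple still has length $\ell$, and $0$ otherwise. $MH_{k,\ell}(a,b)$ and $EMH_{k,\ell}(a,b)$ are the resulting homology groups in degree $k$.
   Formalization: In degree 0, H_* is replaced by reduced homology: for P a point, MH_{2,2}(0̂,1̂)=0 while H_0(Δ(P))=Z, so the unreduced claim fails; for all degrees n>0 the isomorphisms with ordinary H_n(Δ(P)) are stated as well. *)

(* Defs.v *)
From HB Require Import structures.
From mathcomp Require Import all_boot all_order all_algebra.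
From mathcomp Require Import ring_quotient.
From mathcomp Require Import boolp.

Set Implicit Arguments.
Unset Strict Implicit.
Unset Printing Implicit Defensive.

Import Order.TTheory GRing.Theory.
Local Open Scope ring_scope.

Section Homology.
Variables (A B C : zmodType) (g : {additive A -> B}) (f : {additive B -> C}).

Definition ker : {pred B} := fun x => f x == 0.

Lemma ker_zmod_closed : zmod_closed ker.
Proof.
split=> [|x y]; rewrite /in_mem /= /ker ?raddf0 // => /eqP fx /eqP fy.
by rewrite raddfB fx fy subrr.
Qed.
HB.instance Definition _ := GRing.isZmodClosed.Build B ker ker_zmod_closed.

Record cycle := Cycle { cycle_val :> B; _ : cycle_val \in ker }.
HB.instance Definition _ := [isSub for cycle_val].
HB.instance Definition _ := [Choice of cycle by <:].
HB.instance Definition _ := [SubChoice_isSubZmodule of cycle by <:].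

(* The image of [g], read inside the group of cycles; no equation
   [f \o g = 0] is required. *)
Definition bound : {pred cycle} := fun z => `[< exists y : A, g y = val z >].

Lemma bound_zmod_closed : zmod_closed bound.
Proof.
split=> [|x y]; first by apply/asboolP; exists 0; rewrite raddf0.
move=> /asboolP[u gu] /asboolP[v gv].
by apply/asboolP; exists (u - v); rewrite raddfB gu gv.
Qed.
HB.instance Definition _ := GRing.isZmodClosed.Build cycle bound bound_zmod_closed.

Definition homology : zmodType := Quotient.quot bound.

End Homology.

Definition isoZ (A B : zmodType) := exists f : {additive A -> B}, bijective f.

Notation "A ≅ B" := (isoZ A B) (at level 70).

Section TupleComplex.
Variables (T : finType) (X : pred (seq T)).

Definition gens m : finType := {t : m.-tuple T | X t}.

(* The free abelian group on the [m]-tuples satisfying [X]. *)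
Definition chains m : zmodType := {ffun gens m -> int}.

Definition delete i (s : seq T) := take i s ++ drop i.+1 s.

(* The generator [delete i v] if it belongs to [gens n], and 0 otherwise. *)
Definition face i m n (v : gens m) : chains n :=
  [ffun w => (tval (val w) == delete i (val v))%:R].

(* The linear extension of v |-> \sum_(i <- r) (-1)^i (face i v). *)
Definition bd (r : seq nat) m n (c : chains m) : chains n :=
  \sum_(v : gens m) (\sum_(i <- r) face i n v *~ ((-1) ^+ i)) *~ c v.

Lemma bd_is_zmod_morphism r m n : zmod_morphism (@bd r m n).
Proof.
move=> x y; rewrite /bd -sumrB; apply: eq_bigr => v _.
by rewrite !ffunE mulrzBr.
Qed.
HB.instance Definition _ r m n :=
  GRing.isZmodMorphism.Build (chains m) (chains n) (@bd r m n)
    (@bd_is_zmod_morphism r m n).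

End TupleComplex.

Record graph := Graph {
  vertex :> finType;
  edge : rel vertex;
  edge_sym : symmetric edge;
  edge_irr : irreflexive edge }.

Section Graph.
Variable G : graph.

Definition walk (a b : G) (n : nat) : bool :=
  [exists p : n.-tuple G, path (@edge G) a p && (last a p == b)].

Lemma connect_walk a b : connect (@edge G) a b -> exists n, walk a b n.
Proof.
case/connectP=> p ep ->; exists (size p).
by apply/existsP; exists (in_tuple p); rewrite ep eqxx.
Qed.

(* [None] stands for an infinite distance. *)
Definition dist (a b : G) : option nat :=
  match boolP (connect (@edge G) a b) with
  | AltTrue ab => Some (ex_minn (connect_walk ab))
  | AltFalse _ => None
  end.

Lemma distP a b n :
  dist a b = Some n <-> walk a b n /\ (forall m, walk a b m -> (n <= m)%N).
Proof.
rewrite /dist; case: {-}_ / boolP => [ab|nab].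
  case: ex_minnP => k wk mk; split=> [[<-]//|[wn mn]].
  by congr Some; apply/eqP; rewrite eqn_leq mk // mn.
split=> // -[/existsP[p /andP[ep /eqP lp]] _].
by case/negP: nab; apply/connectP; exists p.
Qed.

Definition is_path (s : seq G) : bool :=
  sorted (fun a b => (a != b) && (dist a b != None)) s.

Definition path_length (s : seq G) : nat :=
  if s is a :: s' then sumn (pairmap (fun x y => odflt 0 (dist x y)) a s')
  else 0.

(* Deleting an interior entry keeps both endpoints, and if it creates two equal
   neighbours it strictly shortens the tuple; so the deleted tuple satisfies
   [mag_gen l a b] exactly when its length is still [l], as [face] requires.
   Deletion also preserves [uniq]. *)
Definition mag_gen l (a b : G) : pred (seq G) := fun s =>
  [&& is_path s, path_length s == l, ohead s == Some a & last a s == b].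

Definition emag_gen l (a b : G) : pred (seq G) := fun s =>
  mag_gen l a b s && uniq s.

(* A [k]-path has [k.+1] entries.  As [chains X k.-1.+1] is the group in degree
   [k.-1], the degree 0 group is mapped to itself, but by the empty sum. *)
Definition MC k l (a b : G) : zmodType := chains (mag_gen l a b) k.+1.
Definition MC_bd k l a b : {additive MC k l a b -> MC k.-1 l a b} :=
  bd (index_iota 1 k) k.-1.+1.

Definition EMC k l (a b : G) : zmodType := chains (emag_gen l a b) k.+1.
Definition EMC_bd k l a b : {additive EMC k l a b -> EMC k.-1 l a b} :=
  bd (index_iota 1 k) k.-1.+1.

Definition MH k l (a b : G) : zmodType :=
  homology (MC_bd k.+1 l a b) (MC_bd k l a b).
Definition EMH k l (a b : G) : zmodType :=
  homology (EMC_bd k.+1 l a b) (EMC_bd k l a b).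

End Graph.

Section Poset.
Context {d : Order.disp_t}.
Variable Q : finPOrderType d.
Implicit Types (a b : Q) (C : {set Q}).

Definition chain : pred {set Q} := fun C =>
  [forall a in C, forall b in C, (a >=< b)%O].

Definition maximal_chain C := maxset chain C.

Definition ranked := forall C D, maximal_chain C -> maximal_chain D ->
  #|C| = #|D|.

(* A chain a_0 < ... < a_n has length n: one less than its cardinality. *)
Definition rk : nat := \max_(C : {set Q} | chain C) #|C|.-1.

Lemma ranked_rk C : ranked -> maximal_chain C -> #|C|.-1 = rk.
Proof.
move=> rQ mC; apply/eqP; rewrite eqn_leq; apply/andP; split.
  by apply: (@leq_bigmax_cond _ chain (fun C => #|C|.-1)); case/maxsetP: mC.
apply/bigmax_leqP => D cD; have [E mE DE] := maxset_exists cD.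
by rewrite (rQ _ _ mC mE) -!subn1 leq_sub2r // subset_leq_card.
Qed.

Definition covers b a := (a < b)%O && [forall c, ~~ ((a < c)%O && (c < b)%O)].

Definition hasse_edge : rel Q := fun a b => covers a b || covers b a.

Lemma hasse_edge_sym : symmetric hasse_edge.
Proof. by move=> a b; rewrite /hasse_edge orbC. Qed.

Lemma hasse_edge_irr : irreflexive hasse_edge.
Proof. by move=> a; rewrite /hasse_edge /covers ltxx. Qed.

Definition hasse : graph := Graph hasse_edge_sym hasse_edge_irr.

(* The ordered simplices of the order complex, as strictly increasing
   sequences; those of dimension n have n.+1 entries. *)
Definition simplex : pred (seq Q) := sorted <%O.

Definition OC n : zmodType := chains simplex n.+1.
(* The boundary is zero in degree 0, and \sum_(0 <= i <= n) (-1)^i d_i in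
   degree n > 0. *)
Definition OC_bd n : {additive OC n -> OC n.-1} :=
  bd (if n is 0 then [::] else iota 0 n.+1) n.-1.+1.

Definition OH n : zmodType := homology (OC_bd n.+1) (OC_bd n).

(* The augmented complex, indexed by cardinality: its group of index 0 is the
   copy of Z generated by the empty chain, and a vertex has boundary 1. *)
Definition AOC_bd m : {additive chains simplex m -> chains simplex m.-1} :=
  bd (iota 0 m) m.-1.

(* In [MC_bd] a 2-path (a, x, b) has boundary -(a, b), which is the augmentation
   of the vertex x: in degree 0 magnitude homology sees [reduced_OH], not [OH].
   In degrees n > 0 the two are convertible. *)
Definition reduced_OH n : zmodType := homology (AOC_bd n.+2) (AOC_bd n.+1).

End Poset.

Arguments ranked {d} Q.
Arguments rk {d} Q.
Arguments hasse {d} Q.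
Arguments OH {d} Q n.
Arguments reduced_OH {d} Q n.

Variant hat (T : Type) := Bot | Mid of T | Top.
Arguments Bot {T}.
Arguments Top {T}.

Definition hat_code T (x : hat T) : option (option T) :=
  match x with Bot => None | Top => Some None | Mid x => Some (Some x) end.
Definition hat_decode T (x : option (option T)) : hat T :=
  match x with None => Bot | Some None => Top | Some (Some x) => Mid x end.
Lemma hat_codeK T : cancel (@hat_code T) (@hat_decode T).
Proof. by case. Qed.

HB.instance Definition _ (T : finType) :=
  Finite.copy (hat T) (can_type (@hat_codeK T)).

Section HatOrder.
Context {d : Order.disp_t}.
Variable P : finPOrderType d.

Definition hat_le (x y : hat P) : bool :=
  match x, y with
  | Bot, _ => true
  | _, Top => true
  | Mid x, Mid y => (x <= y)%O
  | _, _ => false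
  end.

Lemma hat_le_refl : reflexive hat_le.
Proof. by case=> //= x; apply: lexx. Qed.
Lemma hat_le_anti : antisymmetric hat_le.
Proof. by case=> [|x|] [|y|] //= /le_anti->. Qed.
Lemma hat_le_trans : transitive hat_le.
Proof. by case=> [|y|] [|x|] [|z|] //=; apply: le_trans. Qed.

HB.instance Definition _ :=
  Order.Le_isPOrder.Build d (hat P) hat_le_refl hat_le_anti hat_le_trans.

End HatOrder.

(* Main.v *)
(** The rank hypothesis makes the Hasse diagram of [hat P] graded by a height
    function that changes by exactly 1 along each edge, so
    [d(a, b) >= |height b - height a|], with equality for comparable [a] and
    [b], and conversely [d(a, b) = height b - height a] forces [a <= b].
    Telescoping along a path from [Bot] to [Top], its length is at least
    [rk (hat P)], with equality exactly when the path is a chain.  Such paths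
    are automatically Eulerian and are the chains [Bot :: t ++ [Top]] with [t] a
    chain of [P]; deleting entry [i.+1] of the former deletes entry [i] of [t],
    so the differentials agree up to sign. *)

Require Import Defs.
From mathcomp Require Import all_boot all_order all_algebra.
From HB Require Import structures.
From mathcomp Require Import ring_quotient boolp zify.

Set Implicit Arguments.
Unset Strict Implicit.
Unset Printing Implicit Defensive.

Import Order.TTheory GRing.Theory.

(** * Chains and the height function of a finite poset *)

Section Chains.
Context {d : Order.disp_t} {Q : finPOrderType d}.
Implicit Types (x y z : Q) (C D E U : {set Q}).

Lemma chainP C :
  reflect {in C &, forall a b : Q, (a >=< b)%O} (chain C).
Proof.
apply: (iffP forall_inP) => [cC a b aC bC|cC a aC].
  by move/forall_inP: (cC a aC); apply.
by apply/forall_inP => b bC; apply: cC.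
Qed.

Lemma chain_sub C D : D \subset C -> chain C -> chain D.
Proof.
by move=> /subsetP DC /chainP cC; apply/chainP => a b /DC aC /DC; apply: cC.
Qed.

Lemma chain1 x : chain [set x].
Proof. by apply/chainP => a b /set1P-> /set1P->; apply: comparablexx. Qed.

Lemma chainU C D : chain C -> chain D ->
  {in C & D, forall a b : Q, (a >=< b)%O} -> chain (C :|: D).
Proof.
move=> /chainP cC /chainP cD cCD; apply/chainP => a b.
case/setUP=> [aC|aD] /setUP[bC|bD]; [exact: cC|exact: cCD| |exact: cD].
by rewrite comparable_sym cCD.
Qed.

Lemma chainU1 x C : chain C -> {in C, forall a : Q, (x >=< a)%O} ->
  chain (x |: C).
Proof.
by move=> cC xC; apply: chainU (chain1 x) cC _ => a b /set1P-> /xC.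
Qed.

Lemma maximal_chainP C :
  maximal_chain C <->
  chain C /\ forall x, {in C, forall a : Q, (x >=< a)%O} -> x \in C.
Proof.
split=> [/maxsetP[cC mC]|[cC mC]].
  split=> // x xC; rewrite -(mC (x |: C)) ?setU11 ?subsetUr //.
  exact: chainU1.
apply/maxsetP; split=> // D cD CD; apply/eqP; rewrite eqEsubset CD andbT.
apply/subsetP => x xD; apply: mC => a aC.
by move/chainP: cD; apply=> //; apply: (subsetP CD).
Qed.

(** Defined on any finite poset; under [ranked] it becomes the rank function. Counting only elements
    strictly below [x] gives a minimum height 0. *)
Definition height x : nat :=
  \max_(C : {set Q} | chain C && (C \subset [set y | (y < x)%O])) #|C|.

Lemma height_max x C :
  chain C -> {in C, forall y, (y < x)%O} -> #|C| <= height x.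
Proof.
move=> cC Cx; apply: (@leq_bigmax_cond _ _ (fun C : {set Q} => #|C|)).
by rewrite cC; apply/subsetP => y /Cx; rewrite inE.
Qed.

(** A chain of largest cardinality below [x] cannot be enlarged there; this last clause is what lets
    it be completed to a maximal chain of [Q]. *)
Lemma height_witness x : exists C, [/\ chain C, {in C, forall y, (y < x)%O},
  #|C| = height x &
  forall z, (z < x)%O -> {in C, forall y : Q, (z >=< y)%O} -> z \in C].
Proof.
have [|C /andP[cC sC] eC] := @eq_bigmax_cond _
    [pred C : {set Q} | chain C && (C \subset [set y | (y < x)%O])]
    (fun C => #|C|).
  apply/card_gt0P; exists set0; rewrite inE /= sub0set andbT.
  by apply/chainP => a b; rewrite inE.
have Cx : {in C, forall y, (y < x)%O}.
  by move=> y /(subsetP sC); rewrite inE.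
exists C; split=> // z zx zC; apply: contraT => zNC.
have: #|z |: C| <= height x.
  apply: height_max; first exact: chainU1.
  by move=> y /setU1P[->|/Cx].
by rewrite cardsU1 zNC /height eC ltnn.
Qed.

Lemma height_lt x y : (x < y)%O -> height x < height y.
Proof.
move=> xy; have [C [cC Cx <- _]] := height_witness x.
have <- : #|x |: C| = #|C|.+1.
  by rewrite cardsU1; case: (boolP (x \in C)) => [/Cx|//]; rewrite ltxx.
apply: height_max; first by apply: chainU1 => // a /Cx/ltW/ge_comparable.
by move=> z /setU1P[->//|/Cx zx]; apply: lt_trans xy.
Qed.

Lemma height_bot x : (forall y, (x <= y)%O) -> height x = 0.
Proof.
move=> xmin; have [C [_ Cx <- _]] := height_witness x.
apply/eqP; rewrite cards_eq0 -subset0; apply/subsetP => y /Cx yx.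
by have := xmin y; rewrite lt_geF.
Qed.

Lemma height_top x : (forall y, (y <= x)%O) -> height x = rk Q.
Proof.
move=> xmax; apply/eqP; rewrite eqn_leq; apply/andP; split.
  have [C [cC Cx <- _]] := height_witness x.
  have <- : #|x |: C|.-1 = #|C|.
    by rewrite cardsU1; case: (boolP (x \in C)) => [/Cx|//]; rewrite ltxx.
  apply: (@leq_bigmax_cond _ (@chain d Q) (fun C => #|C|.-1)).
  by apply: chainU1 => // a _; apply: ge_comparable.
(* Dropping the top element from a chain costs at most one element, which the predecessor in [rk]
   absorbs. *)
apply/bigmax_leqP => C cC; apply: (@leq_trans #|C :\ x|).
  by rewrite (cardsD1 x C); case: (x \in C) => //; apply: leq_pred.
apply: height_max; first by apply: chain_sub cC; apply: subsetDl.
by move=> y /setD1P[yx _]; rewrite lt_neqAle yx xmax.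
Qed.

(** Largest chains [C] below [y] and [D] below [x] are completed by the same upper part [U]: both
    [C :|: U] and [(x |: D) :|: U] are maximal chains, and equating their cardinalities gives
    [#|C| = #|D|.+1]. *)
Lemma cover_height x y : ranked Q -> covers y x -> height y = (height x).+1.
Proof.
move=> rQ /andP[xy /forallP xNy].
have [C [cC Cy <- mC]] := height_witness y.
have [D [cD Dx <- mD]] := height_witness x.
(* [U] is a chain containing [y], maximal among those in the up-set of [y]. *)
have [|U /maxsetP[/andP[cU /subsetP sU] mU] /subsetP yU] := @maxset_exists _
    (fun U => chain U && (U \subset [set z | (y <= z)%O])) [set y].
  by rewrite chain1; apply/subsetP => z /set1P->; rewrite inE.
have {}yU : y \in U by apply: yU; rewrite set11.
have Uy z : z \in U -> (y <= z)%O by move/sU; rewrite inE.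
have {}mU z : (y <= z)%O -> {in U, forall u : Q, (z >=< u)%O} -> z \in U.
  move=> yz zU; rewrite -(mU (z |: U)) ?setU11 ?subsetUr // chainU1 //=.
  by apply/subsetP => u /setU1P[->|/sU//]; rewrite inE.
have glue (V : {set Q}) : chain V -> {in V, forall v, (v < y)%O} ->
    (forall z, (z < y)%O -> {in V, forall v : Q, (z >=< v)%O} -> z \in V) ->
    maximal_chain (V :|: U) /\ #|V :|: U| = #|V| + #|U|.
  move=> cV Vy mV; split; last first.
    apply/eqP; rewrite (leq_card_setU V U).2.
    by apply/pred0P => v /=; apply/andP => -[/Vy vy /Uy]; rewrite lt_geF.
  apply/maximal_chainP; split=> [|z zVU].
    apply: chainU => // a b /Vy ay /Uy yb.
    exact/le_comparable/ltW/(lt_le_trans ay).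
  have zV : {in V, forall a : Q, (z >=< a)%O}.
    by move=> a aV; apply: zVU; rewrite inE aV.
  have zU : {in U, forall a : Q, (z >=< a)%O}.
    by move=> a aU; apply: zVU; rewrite inE aU orbT.
  rewrite inE.
  (* Since [y] lies in [U], [z] is comparable to [y]: above it, maximality of [U] applies, and below
     it, that of [V]. *)
  have yz := zU y yU; rewrite comparable_sym in yz.
  case: (comparable_leP yz) => [{}yz|zy].
    by rewrite mU ?orbT.
  by rewrite mV.
have [mCU eCU] := glue C cC Cy mC.
have [||z zy zxD|mDU eDU] := glue (x |: D).
- by apply: chainU1 => // a /Dx/ltW/ge_comparable.
- by move=> z /setU1P[->//|/Dx zx]; apply: lt_trans xy.
- have zD : {in D, forall v : Q, (z >=< v)%O}.
    by move=> v vD; apply: zxD; rewrite inE vD orbT.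
  (* Here the covering relation enters: nothing lies strictly between [x] and [y], so [z] is [x] or
     lies below [x]. *)
  rewrite in_setU1; have := xNy z; rewrite zy andbT.
  case: (comparable_ltgtP (zxD x (setU11 _ _))) => //= zx _.
  exact: mD.
apply/eqP; rewrite -(eqn_add2r #|U|) -eCU (rQ _ _ mCU mDU) eDU cardsU1.
by case: (boolP (x \in D)) => [/Dx|//]; rewrite ltxx.
Qed.

End Chains.

(** * Isomorphisms of homology groups *)

Section HomologyIso.
Local Open Scope ring_scope.
Local Open Scope quotient_scope.

Section Class.
Variables (A B C : zmodType) (g : {additive A -> B}) (f : {additive B -> C}).

Lemma homology_eqP (x y : Defs.cycle f) :
  reflect (exists z, g z = val x - val y)
    (\pi_(homology g f) x == \pi_(homology g f) y).
Proof.
rewrite -Quotient.idealrBE; apply: (iffP idP) => [/asboolP//|zxy].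
exact/asboolP.
Qed.

Lemma cycle_in_ker (x : Defs.cycle f) : f (val x) = 0.
Proof. exact/eqP/(valP x). Qed.

End Class.

(** Homology depends only on the kernel and the image inside the middle group. Hence one bijection
    matching these suffices, and a sign in the differentials does no harm. *)
Lemma homology_iso (A B C A' B' C' : zmodType)
    (g : {additive A -> B}) (f : {additive B -> C})
    (g' : {additive A' -> B'}) (f' : {additive B' -> C'})
    (phi : {additive B -> B'}) (psi : B' -> B) :
    cancel phi psi -> cancel psi phi ->
    (forall x, f x = 0 <-> f' (phi x) = 0) ->
    (forall x, (exists y, g y = x) <-> (exists y, g' y = phi x)) ->
  homology g f ≅ homology g' f'.
Proof.
move=> phiK psiK phi_cycle phi_bound.
have phi_ker (x : Defs.cycle f) : phi (val x) \in ker f'.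
  by apply/eqP/phi_cycle/cycle_in_ker.
have psi_ker (x : Defs.cycle f') : psi (val x) \in ker f.
  by apply/eqP/phi_cycle; rewrite psiK cycle_in_ker.
pose F (x : homology g f) := \pi_(homology g' f') (Cycle (phi_ker (repr x))).
pose G (x : homology g' f') := \pi_(homology g f) (Cycle (psi_ker (repr x))).
(* Independence of the representative: [phi] sends boundaries to boundaries. *)
have Fpi x :
    F (\pi_(homology g f) x) = \pi_(homology g' f') (Cycle (phi_ker x)).
  apply/eqP/homology_eqP; rewrite /= -[phi _ - _]raddfB.
  apply/phi_bound/homology_eqP.
  by rewrite reprK.
have Gpi x :
    G (\pi_(homology g' f') x) = \pi_(homology g f) (Cycle (psi_ker x)).
  apply/eqP/homology_eqP/phi_bound; rewrite /= raddfB !psiK; apply/homology_eqP.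
  by rewrite reprK.
have Fadd : zmod_morphism F.
  move=> x y; rewrite -[x]reprK -[y]reprK -raddfB !Fpi -raddfB; congr (\pi _).
  by apply: val_inj; rewrite /= raddfB.
pose Fa := GRing.isZmodMorphism.Build _ _ F Fadd.
pose Fm : {additive homology g f -> homology g' f'} := HB.pack F Fa.
exists Fm; exists G => x; rewrite -[x]reprK.
  by rewrite /= Fpi Gpi; congr (\pi _); apply: val_inj; rewrite /= phiK.
by rewrite Gpi /= Fpi; congr (\pi _); apply: val_inj; rewrite /= psiK.
Qed.

Lemma isoZ_sym A B : A ≅ B -> B ≅ A.
Proof.
case=> f [g fK gK].
have gadd : zmod_morphism g.
  by move=> x y; apply: (can_inj fK); rewrite raddfB !gK.
pose ga := GRing.isZmodMorphism.Build _ _ g gadd.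
pose gm : {additive B -> A} := HB.pack g ga.
by exists gm; exists f.
Qed.

End HomologyIso.

(** * Comparing chains of the poset with tuples from bottom to top *)

Section Suspension.
Local Open Scope ring_scope.
Context {d : Order.disp_t} {P : finPOrderType d}.

Definition suspend (t : seq P) : seq (hat P) :=
  Bot :: rcons (map (@Mid P) t) Top.

Lemma suspend_inj : injective suspend.
Proof.
by move=> s t [] /rcons_inj[]; apply: inj_map => x y [].
Qed.

Lemma delete_suspend i t : (i < size t)%N ->
  delete i.+1 (suspend t) = suspend (delete i t).
Proof.
move=> it; rewrite /delete /suspend /= -{1}cats1.
rewrite takel_cat ?size_map ?(ltnW it) //.
by rewrite drop_rcons ?size_map // -rcons_cat map_cat map_take map_drop.
Qed.

Variable X : pred (seq (hat P)).
Hypothesis XP : forall s, X s <-> exists2 t, simplex t & s = suspend t.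

Lemma X_suspend t : simplex t -> X (suspend t).
Proof. by move=> st; apply/XP; exists t. Qed.

Definition suspend_gen m (t : gens (@simplex d P) m) : gens X m.+2 :=
  Sub [tuple of Bot :: rcons (map_tuple (@Mid P) (val t)) Top]
    (X_suspend (valP t)).

Lemma suspend_gen_bij m : bijective (@suspend_gen m).
Proof.
have inj : injective (@suspend_gen m).
  move=> s t /(congr1 (fun u => tval (val u)))/(@suspend_inj) st.
  by do 2!apply: val_inj.
(* The required bound on cardinalities comes from surjectivity: each generator of [X] is the
   suspension of a simplex of the right size. *)
apply: inj_card_bij => //; rewrite -(card_codom inj); apply: subset_leq_card.
apply/subsetP => v _; have [t st vt] := (XP _).1 (valP v).
have tm : size t == m.
  by have := size_tuple (val v); rewrite vt /= size_rcons size_map => -[->].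
apply/codomP; exists (Sub (Tuple tm) st).
by do 2!apply: val_inj => /=.
Qed.

Definition pull m (c : chains X m.+2) : chains (@simplex d P) m :=
  [ffun t => c (suspend_gen t)].

Lemma pull_zmod_morphism m : zmod_morphism (@pull m).
Proof. by move=> x y; apply/ffunP=> t; rewrite !ffunE. Qed.
HB.instance Definition _ m :=
  GRing.isZmodMorphism.Build _ _ (@pull m) (@pull_zmod_morphism m).

Lemma pull_bij m : bijective (@pull m).
Proof.
have [h hK Kh] := suspend_gen_bij m.
pose push (c : chains (@simplex d P) m) : chains X m.+2 := [ffun t => c (h t)].
exists push => c; apply/ffunP => t.
  by rewrite !ffunE Kh.
by rewrite !ffunE hK.
Qed.

(** Interior positions 1, ..., m+1 of a suspension are positions 0, ..., m of the simplex; this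
    shift by one produces the global sign. *)
Lemma pull_bd m (c : chains X m.+3) :
  pull (bd (index_iota 1 m.+2) m.+2 c) = - AOC_bd P m.+1 (pull c).
Proof.
apply/ffunP => w; rewrite !ffunE !sum_ffunE.
rewrite (reindex (@suspend_gen m.+1)) /=; last exact/onW_bij/suspend_gen_bij.
rewrite -sumrN; apply: eq_bigr => v _.
rewrite !ffunE !ffunMzE !sum_ffunE -mulNrz; congr (_ *~ _).
rewrite big_add1 /= -sumrN; apply: eq_big_seq => i.
rewrite mem_index_iota => /= im.
rewrite !ffunMzE !ffunE delete_suspend ?size_tuple // exprS mulN1r mulrNz.
congr (- (_%:R *~ _)); congr (nat_of_bool _).
exact: (inj_eq suspend_inj).
Qed.

(** [X] is kept abstract so that this serves both [mag_gen] and [emag_gen]. *)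
Lemma homology_suspension n :
  homology (@bd _ X (index_iota 1 n.+3) n.+4 n.+3)
           (@bd _ X (index_iota 1 n.+2) n.+3 n.+2) ≅ reduced_OH P n.
Proof.
have [psi phiK psiK] := pull_bij n.+1.
apply: (homology_iso phiK psiK) => [x|x].
  rewrite -[AOC_bd _ _ _]opprK -pull_bd.
  split=> [->|/eqP]; first by rewrite !raddf0.
  rewrite oppr_eq0 => /eqP fx; apply: (bij_inj (pull_bij n)).
  by rewrite fx raddf0.
split=> [[y <-]|[y gy]].
  by exists (- pull y); rewrite raddfN -pull_bd.
have [psi' _ psiK'] := pull_bij n.+2.
(* The minus sign cancels the one in [pull_bd]. *)
exists (psi' (- y)); apply: (bij_inj (pull_bij n.+1)).
by rewrite pull_bd psiK' raddfN opprK.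
Qed.

End Suspension.

(** * Height and distance in the Hasse diagram of a ranked poset *)

Section Distance.
Context {d : Order.disp_t} {Q : finPOrderType d}.
Hypothesis rQ : ranked Q.
Implicit Types (a b : Q) (p s : seq Q).

Lemma hasse_path_height a p : path (@hasse_edge d Q) a p ->
  height (last a p) <= height a + size p /\
  (height (last a p) = height a + size p -> (a <= last a p)%O).
Proof.
elim: p a => [|b p IH] a /=; first by rewrite addn0.
case/andP=> ab /IH[le_h eq_h].
rewrite /hasse_edge orbC in ab; case/orP: ab => [ba|ab].
  move: le_h eq_h; rewrite (cover_height rQ ba) addnS -addSn => le_h eq_h.
  by split=> // /eq_h; apply: le_trans; case/andP: ba => /ltW.
(* A downward edge lowers the height, so the bound becomes strict and equality is impossible. *)
move: le_h eq_h; rewrite (cover_height rQ ab) => le_h _; split; first by lia.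
by move=> eq_h; exfalso; lia.
Qed.

Lemma saturated_path a b : (a <= b)%O ->
  exists p, [/\ path (@hasse_edge d Q) a p, last a p = b &
                size p = height b - height a].
Proof.
move: {2}(height b - height a) (erefl (height b - height a)) => n.
elim: n a => [|n IH] a hn ab.
  exists [::]; split=> //=; apply/eqP; apply: contraT => aNb.
  by have /height_lt : (a < b)%O; [rewrite lt_neqAle aNb|lia].
have ltab : (a < b)%O.
  by rewrite lt_neqAle ab andbT; apply: contra_eqN hn => /eqP->; lia.
have : (a < b <= b)%O by rewrite ltab lexx.
(* An element of least height in the interval above [a] up to [b] must cover [a], as anything in
   between would be lower. *)
case/(@arg_minnP _ b (fun c : Q => a < c <= b)%O height) => c /andP[ac cb] cmin.
have ca : covers c a.
  rewrite /covers ac; apply/forallP => z; apply/negP => /andP[az zc].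
  have := cmin z; rewrite az (ltW (lt_le_trans zc cb)) => /(_ isT).
  by rewrite leqNgt height_lt.
have hc := cover_height rQ ca.
have [|p [cp lp sp]] := IH c _ cb; first by lia.
exists (c :: p); split=> //=; last by lia.
by rewrite cp /hasse_edge ca orbT.
Qed.

Lemma hasse_dist a b : (a <= b)%O ->
  dist (a : hasse Q) b = Some (height b - height a).
Proof.
move=> ab; apply/distP; split=> [|m /existsP[p /andP[ep /eqP lp]]].
  have [p [ep lp <-]] := saturated_path ab.
  by apply/existsP; exists (in_tuple p); rewrite /= ep lp eqxx.
have [+ _] := hasse_path_height ep; rewrite lp size_tuple; lia.
Qed.

Lemma height_dist a b n : dist (a : hasse Q) b = Some n ->
  height b <= height a + n /\ (height b = height a + n -> (a <= b)%O).
Proof.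
case/distP=> /existsP[p /andP[ep /eqP lp]] _.
by have := hasse_path_height ep; rewrite lp size_tuple.
Qed.

Lemma path_length_cons (G : graph) (a b : G) (s : seq G) :
  path_length [:: a, b & s] = odflt 0 (dist a b) + path_length (b :: s).
Proof. by []. Qed.

(** The bounds of [height_dist] telescope; equality in the sum forces equality in every step, hence
    an increase at every step. *)
Lemma height_path_length a s : is_path (a :: s : seq (hasse Q)) ->
  height (last a s) <= height a + path_length (a :: s : seq (hasse Q)) /\
  (height (last a s) = height a + path_length (a :: s : seq (hasse Q)) ->
   path <%O a s).
Proof.
elim: s a => [|b s IH] a; first by rewrite /= addn0.
move: (IH b); rewrite path_length_cons; move: (path_length _) => m {}IH /=.
case/andP=> /andP[aNb].
case ab: dist => [n|] // _ /IH[le_h eq_h].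
have [le_ab eq_ab] := height_dist ab.
split=> /= [|eq_abs]; first by lia.
rewrite eq_h ?andbT; last by lia.
by rewrite lt_neqAle aNb eq_ab //; lia.
Qed.

Lemma sorted_path_length a s : path <%O a s ->
  is_path (a :: s : seq (hasse Q)) /\
  height (last a s) = height a + path_length (a :: s : seq (hasse Q)).
Proof.
elim: s a => [|b s IH] a; first by rewrite /= addn0.
move: (IH b); rewrite path_length_cons; move: (path_length _) => m {}IH /=.
case/andP=> ab /IH[bs ->].
rewrite (hasse_dist (ltW ab)); split; first by rewrite (lt_eqF ab).
by have := height_lt ab; rewrite /=; lia.
Qed.

(** The heights of [x] and [y] are 0 and [rk Q], so [rk Q] is the extreme case of the telescoped
    inequality, attained by chains alone. *)
Lemma mag_gen_extremal x y (s : seq Q) :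
  (forall z, (x <= z)%O) -> (forall z, (z <= y)%O) ->
  mag_gen (G := hasse Q) (rk Q) x y s =
  [&& sorted <%O s, ohead s == Some x & last x s == y].
Proof.
move=> xmin ymax; case: s => [|z s]; first by rewrite /mag_gen /= andbF.
rewrite /mag_gen -(height_top ymax); apply/idP/idP.
  case/and4P=> xs /eqP lxs /eqP[zx] /eqP /= sy; subst z.
  rewrite sy !eqxx !andbT; have [_] := height_path_length xs; apply.
  by rewrite (height_bot xmin) lxs sy.
case/and3P=> /= xs /eqP[zx] /eqP sy; subst z.
have [xs' eq_h] := sorted_path_length xs.
rewrite (height_bot xmin) sy in eq_h.
by apply/and4P; split; rewrite /= ?sy ?eq_h.
Qed.

End Distance.

(** * Adjoining a minimum and a maximum *)

Section Hat.
Context {d : Order.disp_t} {P : finPOrderType d}.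

(** Every maximal chain contains [Bot] and [Top], being comparable to everything; removing them
    leaves a maximal chain of [P] with two elements fewer. *)
Lemma ranked_hat : ranked P -> ranked (hat P).
Proof.
have key (C : {set hat P}) : maximal_chain C ->
    maximal_chain [set x | Mid x \in C] /\ #|C| = #|[set x | Mid x \in C]|.+2.
  case/maximal_chainP=> /chainP cC mC.
  have B : Bot \in C by apply: mC => a _; exact: le_comparable.
  have T : Top \in C by apply: mC => -[|a|] _; exact: ge_comparable.
  split.
    apply/maximal_chainP; split.
      by apply/chainP => a b; rewrite !inE => aC bC; have := cC _ _ aC bC.
    move=> x xC; rewrite inE; apply: mC => -[|a|] // aC.
    by have := xC a; rewrite inE; apply.
  have Mid_inj : injective (@Mid P) by move=> x y [].
  rewrite (cardsD1 Bot) B (cardsD1 Top) !inE T /= -(card_imset _ Mid_inj).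
  rewrite !addnA; congr (_ + _); apply: eq_card => -[|x|]; rewrite !inE /=.
  - by apply/esym/negP => /imsetP[].
  - by rewrite mem_imset ?inE.
  - by apply/esym/negP => /imsetP[].
move=> rP C D /key[mC ->] /key[mD ->].
by rewrite (rP _ _ mC mD).
Qed.

Lemma simplex_suspend (t : seq P) : simplex (suspend t) = simplex t.
Proof.
rewrite /simplex !lt_sorted_pairwise /suspend pairwise_cons pairwise_rcons.
rewrite all_rcons /= !all_map pairwise_map.
rewrite (eq_all (a2 := xpredT)) ?all_predT /=; last first.
  by move=> x; exact: lt_neqAle.
congr pairwise; apply/funext => x; apply/funext => y.
by rewrite /= !lt_neqAle.
Qed.

Lemma sorted_hat (s : seq (hat P)) :
  [&& sorted <%O s, ohead s == Some Bot & last Bot s == Top] <->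
  exists2 t, simplex t & s = suspend t.
Proof.
split=> [|[t st ->]]; last first.
  apply/and3P; split=> //; last by rewrite /= last_rcons.
  by have := simplex_suspend t; rewrite st.
case/lastP: s => [|s y]; first by case/and3P.
case: s => [|x s]; first by case/and3P=> _ /eqP[->].
rewrite /= last_rcons => /and3P[ss /eqP[xB] /eqP yT]; subst x y.
suff [t st] : exists t, s = map (@Mid P) t.
  by exists t; rewrite /suspend -?st // -simplex_suspend /suspend -st.
(* The pairwise form compares each entry of [s] directly with [Bot] and [Top], which excludes both
   values. *)
have : pairwise <%O (Bot :: rcons s Top) by rewrite -lt_sorted_pairwise.
rewrite pairwise_cons pairwise_rcons all_rcons => /and3P[/andP[_ sB] sT _].
elim: s {ss} sB sT => [|[|x|] s IH] //=; first by exists [::].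
by move=> /IH{}IH /IH[t ->]; exists (x :: t).
Qed.

End Hat.

(** * Magnitude homology in extremal length is the homology of the order complex *)

Theorem theorem4p7 (d : Order.disp_t) (P : finPOrderType d) :
  ranked P ->
  let G : graph := hasse (hat P : finPOrderType d) in
  let r : nat := rk (hat P : finPOrderType d) in
  (forall n : nat,
     MH n.+2 r (Bot : G) (Top : G) ≅ reduced_OH P n /\
     reduced_OH P n ≅ EMH n.+2 r (Bot : G) (Top : G)) /\
  (forall n : nat, 0 < n ->
     MH n.+2 r (Bot : G) (Top : G) ≅ OH P n /\
     OH P n ≅ EMH n.+2 r (Bot : G) (Top : G)).
Proof.
move=> rP G r; have rH := ranked_hat rP.
have magP (s : seq (hat P)) :
    @mag_gen G r Bot Top s <-> exists2 t, simplex t & s = suspend t.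
  rewrite -sorted_hat (mag_gen_extremal rH) //; first by case.
have emagP (s : seq (hat P)) :
    @emag_gen G r Bot Top s <-> exists2 t, simplex t & s = suspend t.
  rewrite -magP /emag_gen; split=> [/andP[]//|sG]; rewrite sG /=.
  have [t st ->] := (magP s).1 sG.
  (* Such a path is strictly increasing, hence already Eulerian. *)
  by apply: (@lt_sorted_uniq _ (hat P)); rewrite -simplex_suspend in st.
have isoM n : MH n.+2 r (Bot : G) (Top : G) ≅ reduced_OH P n.
  exact: homology_suspension magP n.
have isoE n : reduced_OH P n ≅ EMH n.+2 r (Bot : G) (Top : G).
  by apply: isoZ_sym; exact: homology_suspension emagP n.
(* In positive degree [OH] is convertible to [reduced_OH], so the same isomorphisms apply. *)
split=> [n|[//|n] _]; split; [exact: isoM|exact: isoE|exact: isoM n.+1|].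
exact: isoE n.+1.
Qed.
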